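(* There exist pairs $(G,\alpha)$, where $G$ is a Banach--Lie group and $\alpha\colon\mathbb R\to\mathrm{Aut}(G)$ defines a smooth action of $\mathbb R$ on $G$, such that not all smooth ground state representations of $(G,\alpha)$ are strict.
   Context: Put $G^0=\{g\in G:\alpha_t(g)=g\ \forall t\}$. A positive energy representation of $(G,\alpha)$ is a triple $(\pi,U,\mathcal H)$ with $(\pi,\mathcal H)$ a (strongly continuous) unitary representation of $G$ and $U_t=e^{itH}$ a strongly continuous unitary one-parameter group with $H=H^*\ge0$ and $U_t\pi(g)U_{-t}=\pi(\alpha_t(g))$. Its minimal energy space is $\mathcal H^0=\ker H$, carrying the representation $\pi^0(g)=\pi(g)|_{\mathcal H^0}$ of $G^0$. It is a ground state representation if $\pi(G)\mathcal H^0$ spans a dense subspace of $\mathcal H$; smooth if the vectors in $\mathcal H^0$ with smooth orbit map $g\mapsto\pi(g)\xi$ are dense in $\mathcal H^0$; strict if every bounded operator on $\mathcal H^0$ commuting with $\pi^0(G^0)$ extends to a bounded operator on $\mathcal H$ commuting with $\pi(G)$. *)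

(* Defs.v *)
From HB Require Import structures.
From mathcomp Require Import all_boot all_order all_algebra.
From mathcomp Require Import sesquilinear.
From mathcomp Require Import all_classical all_reals all_analysis.
From mathcomp Require Export complex.

Set Implicit Arguments.
Unset Strict Implicit.
Unset Printing Implicit Defensive.

Import Order.TTheory GRing.Theory Num.Theory.
Import numFieldNormedType.Exports.

Local Open Scope classical_set_scope.
Local Open Scope ring_scope.
Local Open Scope complex_scope.

(* C^k on an open set [D]: the directional derivatives exist on [D] and
   [(x, v) |-> 'D_v f x] is C^(k-1) on [D `*` setT].  For every finite [k > 0] this
   is weaker than Frechet-C^k, but it gives the same C^oo maps.
   [{within D, continuous f}] is ordinary continuity on [D] as [D] is open. *)
Fixpoint Ck (R : realType) (k : nat) :
    forall E F : normedModType R, set E -> (E -> F) -> Prop :=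
  fun E F D f =>
  {within D, continuous f} /\
  (if k is k'.+1 then
     (forall x v, D x -> derivable f x v) /\
     Ck k' (D `*` [set: E]) (fun p : E * E => 'D_(p.2) f p.1)
   else True).

Definition smooth_on (R : realType) (E F : normedModType R)
  (D : set E) (f : E -> F) : Prop := forall k, Ck k D f.

(* Only the values of [cmap] on [cdom] and of [cinv] on [cmap @` cdom] are
   meaningful. *)
Record chart (R : realType) (M : topologicalType) (E : normedModType R) :=
  Chart { cdom : set M ; cmap : M -> E ; cinv : E -> M }.

Definition is_chart (R : realType) (M : topologicalType) (E : normedModType R)
    (c : chart M E) : Prop :=
  [/\ open (cdom c), open (cmap c @` cdom c),
      {within cdom c, continuous (cmap c)},
      {within cmap c @` cdom c, continuous (cinv c)} &
      forall x, cdom c x -> cinv c (cmap c x) = x].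

Definition smooth_atlas (R : realType) (M : topologicalType)
    (E : normedModType R) (A : set (chart M E)) : Prop :=
  [/\ forall c, A c -> is_chart c,
      forall x, exists2 c, A c & cdom c x &
      forall c d, A c -> A d ->
        smooth_on (cmap c @` (cdom c `&` cdom d)) (cmap d \o cinv c)].

Definition prod_chart (R : realType) (M N : topologicalType)
    (E F : normedModType R) (c : chart M E) (d : chart N F) :
    chart (M * N)%type (E * F)%type :=
  Chart (cdom c `*` cdom d)
        (fun p : M * N => (cmap c p.1, cmap d p.2))
        (fun p : E * F => (cinv c p.1, cinv d p.2)).

Definition prod_atlas (R : realType) (M N : topologicalType)
    (E F : normedModType R) (A : set (chart M E)) (B : set (chart N F)) :
    set (chart (M * N)%type (E * F)%type) :=
  [set prod_chart c d | c in A & d in B].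

Definition model_atlas (R : realType) (E : normedModType R) : set (chart E E) :=
  [set Chart setT idfun idfun].

Definition smooth_map (R : realType) (M N : topologicalType)
    (E F : normedModType R) (A : set (chart M E)) (B : set (chart N F))
    (f : M -> N) : Prop :=
  continuous f /\
  forall c d, A c -> B d ->
    smooth_on (cmap c @` (cdom c `&` f @^-1` cdom d)) (cmap d \o f \o cinv c).

#[short(type="topGroupType")]
HB.structure Definition TopGroup := {G of Group G & Topological G}.

Record banachLieGroup (R : realType) := BanachLieGroup {
  blg_sort :> topGroupType ;
  blg_model : completeNormedModType R ;
  blg_atlas : set (chart blg_sort blg_model) ;
  blg_hausdorff : hausdorff_space blg_sort ;
  blg_atlasP : smooth_atlas blg_atlas ;
  blg_mul_smooth : smooth_map (prod_atlas blg_atlas blg_atlas) blg_atlas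
    (fun p : blg_sort * blg_sort => (p.1 * p.2)%g) ;
  blg_inv_smooth : smooth_map blg_atlas blg_atlas (fun x : blg_sort => (x^-1)%g)
}.

Arguments blg_atlas {R} b.

(* A homomorphism [alpha] from (R, +) to Aut(G) whose action map R * G -> G is
   smooth; bijectivity of [alpha t] follows from the group law. *)
Record smooth_action (R : realType) (G : banachLieGroup R)
    (alpha : R -> G -> G) : Prop := SmoothAction {
  act_morph : forall t, {morph alpha t : x y / (x * y)%g} ;
  act_0 : forall x, alpha 0 x = x ;
  act_add : forall s t x, alpha (s + t) x = alpha s (alpha t x) ;
  act_smooth : smooth_map (prod_atlas (@model_atlas R R^o) (blg_atlas G))
    (blg_atlas G) (fun p : R^o * G => alpha p.1 p.2)
}.

Definition fixed_points (R : realType) (G : banachLieGroup R)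
  (alpha : R -> G -> G) : set G := [set g | forall t, alpha t g = g].

(* MathComp convention: the inner product is linear in its first argument. *)
Record hilbertSpace (R : realType) := HilbertSpace {
  hs_sort :> completeNormedModType R[i] ;
  hs_ip : {dot hs_sort for @Num.conj R[i]} ;
  hs_normE : forall x : hs_sort, `|x| ^+ 2 = hs_ip x x
}.

(* [V] with scalars restricted to R: Banach-Lie groups are real, so orbit maps
   into a complex Hilbert space are differentiated over R. *)
Definition realify (R : realType) (V : normedModType R[i]) : Type := V.

Section Realify.
Variables (R : realType) (V : normedModType R[i]).

HB.instance Definition _ := GRing.Zmodule.on (realify V).

Let scale (a : R) (x : realify V) : realify V := a%:C *: (x : V).

Let scaleA a b x : scale a (scale b x) = scale (a * b) x.
Proof. by rewrite /scale scalerA rmorphM. Qed.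

Let scale1 : left_id 1 scale.
Proof. by move=> x; rewrite /scale rmorph1 scale1r. Qed.

Let scaleDr : right_distributive scale +%R.
Proof. by move=> a x y; rewrite /scale scalerDr. Qed.

Let scaleDl x : {morph scale^~ x : a b / a + b}.
Proof. by move=> a b; rewrite /scale rmorphD scalerDl. Qed.

HB.instance Definition _ :=
  GRing.Zmodule_isLmodule.Build R (realify V) scaleA scale1 scaleDr scaleDl.

Let rnorm (x : realify V) : R := complex.Re `|x : V|.

Let rnormE x : (rnorm x)%:C = `|x : V|.
Proof. by rewrite /rnorm RRe_real// normr_real. Qed.

Let rnormD x y : rnorm (x + y) <= rnorm x + rnorm y.
Proof. rewrite -lecR rmorphD /= !rnormE; exact: ler_normD. Qed.

Let rnormZ a x : rnorm (a *: x) = `|a| * rnorm x.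
Proof.
rewrite /rnorm normrZ normc_def /= expr0n addr0 sqrtr_sqr.
by case: (`|x : V|) => r s /=; rewrite mul0r subr0.
Qed.

Let rnorm0 x : rnorm x = 0 -> x = 0.
Proof. by move=> x0; apply: (@normr0_eq0 _ V); rewrite -rnormE x0. Qed.

HB.instance Definition _ :=
  Lmodule_isNormed.Build R (realify V) rnormD rnormZ rnorm0.

End Realify.

Definition unitary (R : realType) (H : hilbertSpace R) (u : H -> H) : Prop :=
  [/\ linear u, forall x y, hs_ip H (u x) (u y) = hs_ip H x y &
      forall y, exists x, u x = y].

Definition span (K : numDomainType) (V : lmodType K) (S : set V) : set V :=
  [set x | exists (n : nat) (a : 'I_n -> K) (v : 'I_n -> V),
     (forall i, S (v i)) /\ x = \sum_(i < n) a i *: v i].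

(* Bounded operators on a linear subspace [D]; the values of [A] outside [D]
   are irrelevant. *)
Definition bounded_operator (R : realType) (H : hilbertSpace R)
    (D : set H) (A : H -> H) : Prop :=
  [/\ forall x, D x -> D (A x),
      forall (a : R[i]) x y, D x -> D y -> A (a *: x + y) = a *: A x + A y &
      exists C : R[i], forall x, D x -> `|A x| <= C * `|x|].

(* Unbounded operators are given by their graphs.  The adjoint of a densely
   defined operator is single-valued and linear, hence so is every graph
   satisfying [self_adjoint]. *)
Definition adjoint (R : realType) (H : hilbertSpace R) (T : set (H * H)) :
    set (H * H) :=
  [set p | forall q, T q -> hs_ip H q.2 p.1 = hs_ip H q.1 p.2].

Definition self_adjoint (R : realType) (H : hilbertSpace R)
    (T : set (H * H)) : Prop :=
  dense (fst @` T) /\ adjoint T = T.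

Definition nonnegative (R : realType) (H : hilbertSpace R)
    (T : set (H * H)) : Prop :=
  forall p, T p -> 0 <= hs_ip H p.2 p.1.

(* [T] generates [U], i.e. [U t = exp (i t T)] in the sense of Stone's theorem:
   the domain of [T] is the set of [x] at which [t |-> U t x] is
   differentiable at 0, with derivative ['i *: T x]. *)
Definition generates (R : realType) (H : hilbertSpace R)
    (T : set (H * H)) (U : R -> H -> H) : Prop :=
  forall x y : H,
    T (x, y) <-> (t^-1)%:C *: (U t x - x) @[t --> (0 : R)^'] --> 'i *: y.

Record posEnergyRep (R : realType) (G : banachLieGroup R)
    (alpha : R -> G -> G) := PosEnergyRep {
  per_space : hilbertSpace R ;
  per_pi : G -> per_space -> per_space ;
  per_U : R -> per_space -> per_space ;
  per_energy : set (per_space * per_space) ;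
  per_pi_unitary : forall g, unitary (per_pi g) ;
  per_pi_mul : forall g h x, per_pi (g * h)%g x = per_pi g (per_pi h x) ;
  per_pi_continuous : forall x, continuous (per_pi^~ x) ;
  per_U_unitary : forall t, unitary (per_U t) ;
  per_U_add : forall s t x, per_U (s + t) x = per_U s (per_U t x) ;
  per_U_continuous : forall x, continuous (per_U^~ x) ;
  per_energy_self_adjoint : self_adjoint per_energy ;
  per_energy_ge0 : nonnegative per_energy ;
  per_U_exp : generates per_energy per_U ;
  per_covariant : forall t g x,
    per_U t (per_pi g (per_U (- t) x)) = per_pi (alpha t g) x
}.

Arguments per_pi {R G alpha} p _ _.
Arguments per_U {R G alpha} p _ _.
Arguments per_energy {R G alpha} p _.

Section Properties.
Variables (R : realType) (G : banachLieGroup R) (alpha : R -> G -> G).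
Variable rho : posEnergyRep alpha.

Let H := per_space rho.

Definition minimal_energy_space : set H := [set x | per_energy rho (x, 0)].

Definition ground_state_rep : Prop :=
  dense (span [set y : H | exists g x,
    minimal_energy_space x /\ y = per_pi rho g x]).

Definition smooth_vector (x : H) : Prop :=
  smooth_map (blg_atlas G) (@model_atlas R (realify H))
    (fun g : G => per_pi rho g x : realify H).

Definition smooth_rep : Prop :=
  minimal_energy_space `<=` closure (minimal_energy_space `&` smooth_vector).

Definition strict_rep : Prop :=
  forall A : H -> H, bounded_operator minimal_energy_space A ->
    (forall g x, fixed_points alpha g -> minimal_energy_space x ->
       A (per_pi rho g x) = per_pi rho g (A x)) ->
  exists B : H -> H,
    [/\ bounded_operator [set: H] B,
        forall g x, B (per_pi rho g x) = per_pi rho g (B x) &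
        forall x, minimal_energy_space x -> B x = A x].

End Properties.

(* Main.v *)
(* Take G = R x| {1, -1}, the isometry group of the real line, with alpha_t the
   conjugation by the translation by t.  A translation is fixed by alpha_t, a
   reflection gets translated by 2t, so G^0 is the group of translations.  Let G
   act on C^2 through G / R = {1, -1}, the nontrivial element exchanging the two
   coordinates.  As alpha_t is trivial on G / R, this is a positive energy
   representation with U_t = 1 and zero energy: the minimal energy space is all
   of C^2, all orbit maps are locally constant, and G^0 acts trivially.  Hence
   every operator commutes with G^0, but the projection onto the first
   coordinate does not commute with the exchange of coordinates. *)
Require Import Defs.
From HB Require Import structures.
From mathcomp Require Import all_boot all_order all_algebra.
From mathcomp Require Import sesquilinear spectral lra.
From mathcomp Require Import all_classical all_reals all_analysis.

Set Implicit Arguments.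
Unset Strict Implicit.
Unset Printing Implicit Defensive.

Import Order.TTheory GRing.Theory Num.Theory.
Import numFieldNormedType.Exports.

Local Open Scope classical_set_scope.
Local Open Scope ring_scope.
Local Open Scope complex_scope.

(** * The Hilbert space C^n *)

Lemma normc_ge_Im (R : realType) (z : R[i]) : `|complex.Im z|%:C <= `|z|.
Proof.
case: z => a b; rewrite normc_def lecR/= -sqrtr_sqr.
by apply: ler_wsqrtr; rewrite lerDr sqr_ge0.
Qed.

Lemma normc_le_ReIm (R : realType) (z : R[i]) :
  `|z| <= (`|complex.Re z| + `|complex.Im z|)%:C.
Proof.
rewrite {1}[z]complexE rmorphD/=; apply: le_trans (ler_normD _ _) _.
rewrite lerD// ?normrM !normc_def/= ?expr0n/= ?addr0 ?add0r ?expr1n.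
  by rewrite sqrtr_sqr.
by rewrite sqrtr1 mul1r sqrtr_sqr.
Qed.

(* An alias, as 'rV[R[i]]_n itself carries the sup norm. *)
Definition euclid (R : realType) (n : nat) : Type := 'rV[R[i]]_n.

Section Euclid.
Variables (R : realType) (n : nat).

HB.instance Definition _ := GRing.Lmodule.on (euclid R n).

Definition edot (x y : euclid R n) : R[i] := dotmx x y.
HB.instance Definition _ := Dot.copy edot (@dotmx R[i] n).

Let norm (x : euclid R n) : R[i] := sqrtC (edot x x).

Let normD x y : norm (x + y) <= norm x + norm y.
Proof. by have [] := triangle_lerif (@dotmx R[i] n) x y. Qed.

Let normZ (a : R[i]) x : norm (a *: x) = `|a| * norm x.
Proof.
by rewrite /norm dnormZ sqrtCM ?nnegrE ?exprn_ge0 ?dnorm_ge0// exprCK.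
Qed.

Let norm0 x : norm x = 0 -> x = 0.
Proof. by move/eqP; rewrite sqrtC_eq0 dnorm_eq0 => /eqP. Qed.

HB.instance Definition _ :=
  Lmodule_isNormed.Build R[i] (euclid R n) normD normZ norm0.

Lemma euclid_normE (x : euclid R n) : `|x| ^+ 2 = edot x x.
Proof. exact: sqrtCK. Qed.

Lemma edotE (x y : euclid R n) : edot x y = \sum_i x 0 i * (y 0 i)^*.
Proof. by rewrite /edot dotmxE mxE; apply: eq_bigr => i _; rewrite !mxE. Qed.

Lemma ler_euclid_coord (x : euclid R n) (i : 'I_n) : `|x 0 i| <= `|x|.
Proof.
rewrite -ler_sqr ?nnegrE// euclid_normE edotE (bigD1 i)//= normCK lerDl.
by rewrite sumr_ge0// => j _; exact: mul_conjC_ge0.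
Qed.

Lemma euclid_norm_le (x : euclid R n) : `|x| <= \sum_i `|x 0 i|.
Proof.
have nd (i : 'I_n) : `|delta_mx 0 i : euclid R n| = 1.
  apply/eqP; rewrite -(@eqrXn2 _ 2)// expr1n euclid_normE edotE (bigD1 i)//=.
  rewrite mxE !eqxx/= conjC1 mulr1 big1 ?addr0// => j ji.
  by rewrite mxE (negPf ji) mul0r.
rewrite [in X in X <= _](row_sum_delta x).
apply: (le_trans (ler_norm_sum _ _ _)).
by apply: ler_sum => i _; rewrite normrZ nd mulr1.
Qed.

(** Real and imaginary parts of each coordinate are 1-Lipschitz, so they send [F] to Cauchy filters
    on the real line. The row of their limits is the limit of [F], because the norm is at most the
    sum of the moduli of the coordinates. *)
Lemma euclid_complete (F : set_system (euclid R n)) :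
  ProperFilter F -> cauchy F -> cvg F.
Proof.
move=> FF /cauchy_ballP Fc.
have cvg_coord (f : euclid R n -> R) :
    (forall x y, `|f x - f y|%:C <= `|x - y|) -> cvg (f @ F).
  move=> fL; apply: cauchy_cvg; apply/cauchy_ballP => e e0; rewrite near_map2.
  have e0' : 0 < e%:C by rewrite ltcR.
  have := Fc _ e0'; apply: filterS => -[x y].
  by rewrite -!ball_normE/= -ltcR; exact: le_lt_trans (fL _ _).
pose re i (x : euclid R n) : R := complex.Re (x 0 i).
pose im i (x : euclid R n) : R := complex.Im (x 0 i).
have reC i : cvg (re i @ F).
  apply: cvg_coord => x y; apply: le_trans (ler_euclid_coord _ i).
  by rewrite /re -raddfB !mxE; exact: normc_ge_Re.
have imC i : cvg (im i @ F).
  apply: cvg_coord => x y; apply: le_trans (ler_euclid_coord _ i).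
  by rewrite /im -raddfB !mxE; exact: normc_ge_Im.
apply/cvg_ex; exists (\row_i (lim (re i @ F) +i* lim (im i @ F))).
apply/cvgrPdist_lt => e e0.
(* A positive element of [R[i]] is real, so the estimate can be done in [R]. *)
have eR : e = (complex.Re e)%:C by rewrite RRe_real// gtr0_real.
(* With real and imaginary parts each within [d], the [n] coordinates add up to at most 2nd = e * n
   / (n + 1) < e. Using n + 1 also covers n = 0. *)
pose d : R := complex.Re e / (n.+1.*2)%:R.
have d0 : 0 < d by rewrite divr_gt0// -ltcR -eR.
near=> x; apply: (le_lt_trans (euclid_norm_le _)).
have le2d i : `|(\row_i (lim (re i @ F) +i* lim (im i @ F)) - x
    : euclid R n) 0 i| <= (d + d)%:C.
  apply: (le_trans (normc_le_ReIm _)).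
  rewrite lecR !mxE/= !raddfB/= lerD// ltW//.
    move: i; near: x; apply: filter_forall => i.
    have /cvgrPdist_lt/(_ _ d0) := reC i; exact.
  move: i; near: x; apply: filter_forall => i.
  have /cvgrPdist_lt/(_ _ d0) := imC i; exact.
apply: (le_lt_trans (ler_sum _ (fun i _ => le2d i))).
rewrite sumr_const card_ord -rmorphMn/= [ltRHS]eR ltcR.
rewrite -mulr2n -mulrnA -[ltLHS]mulr_natr /d mulrAC ltr_pdivrMr ?ltr0n//.
rewrite ltr_pM2l ?ltr_nat ?mul2n ?ltn_double// -ltcR -eR.
Unshelve. all: by end_near. Qed.

HB.instance Definition _ :=
  Uniform_isComplete.Build (euclid R n) euclid_complete.

End Euclid.

(** * Smoothness of affine maps *)

Lemma is_derive_affine (R : realType) (E F : normedModType R)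
    (L : {linear E -> F}) (c : F) (x v : E) :
  is_derive x v (fun z => L z + c) (L v).
Proof.
have lim0 : (fun h => h^-1 *: (((fun z => L z + c) \o shift x) (h *: v)
     - (L x + c))) @ (0 : R)^' --> L v.
  apply: cvg_near_cst; near=> h.
  rewrite /= linearP opprD addrACA subrr addr0 addrK scalerA.
  by rewrite mulVf ?scale1r//; near: h; exact: nbhs_dnbhs_neq.
by apply: DeriveDef; [apply/cvg_ex; exists (L v)|exact/norm_cvg_lim].
Unshelve. all: by end_near. Qed.

(** The directional derivative of [L z + c] at [x] along [v] is [L v]. As a function of the pair it
    is [L \o snd], again continuous and linear, so the induction must range over all spaces [E]. *)
Lemma Ck_affine (R : realType) (k : nat) (E F : normedModType R) (D : set E)
    (L : {linear E -> F}) (c : F) :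
  continuous L -> Ck k D (fun z => L z + c).
Proof.
have fc (E' : normedModType R) (L' : {linear E' -> F}) c' (D' : set E') :
    continuous L' -> {within D', continuous (fun z => L' z + c')}.
  move=> Lc; apply: continuous_subspaceT => z.
  by apply: cvgD; [exact: Lc|exact: cvg_cst].
elim: k E L c D => [|k IH] E L c D Lc /=; split=> //; try exact: fc.
have Ld x v := is_derive_affine L c x v.
split=> [x v _|]; first exact: ex_derive.
rewrite (_ : (fun p => _) = (fun p => (L \o snd) p + 0)).
  apply: (IH _ (L \o snd : {linear _ -> _}) 0).
  by move=> p; apply: continuous_comp; [exact: cvg_snd|exact: Lc].
by apply/funext => p; rewrite addr0/= derive_val.
Qed.

(** All smoothness claims below reduce to this one: in the charts used, every map involved is
    affine. *)
Lemma smooth_affine (R : realType) (E F : normedModType R) (D : set E)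
    (L : E -> F) (c : F) (f : E -> F) :
  linear L -> continuous L -> (forall z, f z = L z + c) -> smooth_on D f.
Proof.
move=> Ll Lc /funext-> k.
pose L' : {linear E -> F} := HB.pack L (GRing.isLinear.Build _ _ _ _ L Ll).
exact: (@Ck_affine _ _ _ _ _ L').
Qed.

(** * Continuity and separation in products and discrete spaces *)

Lemma fst_continuous (T U : topologicalType) : continuous (@fst T U).
Proof. by move=> p; exact: cvg_fst. Qed.

Lemma snd_continuous (T U : topologicalType) : continuous (@snd T U).
Proof. by move=> p; exact: cvg_snd. Qed.

Lemma pair_continuous (T U V : topologicalType) (f : T -> U) (g : T -> V) :
  continuous f -> continuous g -> continuous (fun x => (f x, g x)).
Proof. by move=> fc gc x; apply: cvg_pair; [exact: fc|exact: gc]. Qed.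

Lemma discrete_continuous (T : discreteTopologicalType) (U : topologicalType)
    (f : T -> U) : continuous f.
Proof.
move=> x A /nbhs_singleton Ax; rewrite nbhs_simpl/= nbhs_principalE.
exact/principal_filterP.
Qed.

(** Since [bool] is discrete, [q] is locally constant, and near [x] the map agrees with [f (q x)].
    This allows the component of a group element to be fixed before continuity is checked. *)
Lemma continuous_glue (T U : topologicalType) (q : T -> bool)
    (f : bool -> T -> U) :
  continuous q -> (forall b, continuous (f b)) ->
  continuous (fun x => f (q x) x).
Proof.
move=> qc fc x.
have qx : \forall y \near x, q y = q x.
  by apply: (qc x [set q x]); rewrite nbhs_principalE; exact/principal_filterP.
apply: cvg_trans (fc (q x) x); apply: near_eq_cvg.
by apply: filterS qx => y ->.
Qed.

Lemma prod_hausdorff (T U : topologicalType) :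
  hausdorff_space T -> hausdorff_space U -> hausdorff_space (T * U)%type.
Proof.
move=> hT hU [p1 p2] [q1 q2] pq; congr pair.
  apply: hT => A B Ap Bq.
  have [|z [? ?]] := pq (fst @^-1` A) (fst @^-1` B) _
    (@fst_continuous _ _ (q1, q2) _ Bq).
    exact: (@fst_continuous _ _ (p1, p2)).
  by exists z.1.
apply: hU => A B Ap Bq.
have [|z [? ?]] := pq (snd @^-1` A) (snd @^-1` B) _
  (@snd_continuous _ _ (q1, q2) _ Bq).
  exact: (@snd_continuous _ _ (p1, p2)).
by exists z.2.
Qed.

(* [(x, b)] stands for the isometry [y |-> x + (-1)^b y]. *)
Definition isomLine (R : realType) : Type := (R^o * bool)%type.

(** * The isometry group of the line and its action of R *)

Section IsomLine.
Variable R : realType.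
Let G := isomLine R.
HB.instance Definition _ := Choice.on G.
HB.instance Definition _ := Topological.copy G (R^o * bool)%type.

(** The linear part of the isometries in component [b]. *)
Definition reflection (b : bool) (x : R^o) : R^o := if b then - x else x.

Definition isom_mul (g h : G) : G := (g.1 + reflection g.2 h.1, g.2 (+) h.2).
Definition isom_one : G := (0, false).
Definition isom_inv (g : G) : G := (- reflection g.2 g.1, g.2).

Let mulA : associative isom_mul.
Proof.
by move=> [x [] ] [y []] [z []]; rewrite /isom_mul/= ?opprD ?opprK addrA.
Qed.
Let mul1 : left_id isom_one isom_mul.
Proof. by case=> x b; rewrite /isom_mul/= add0r. Qed.
Let mulr1 : right_id isom_one isom_mul.
Proof. by case=> x []; rewrite /isom_mul/= ?oppr0 addr0. Qed.
Let mulV : left_inverse isom_one isom_inv isom_mul.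
Proof. by case=> x []; rewrite /isom_mul/isom_inv/= ?opprK ?addNr ?subrr. Qed.
Let mulrV : right_inverse isom_one isom_inv isom_mul.
Proof. by case=> x []; rewrite /isom_mul/isom_inv/= ?opprK subrr. Qed.

HB.instance Definition _ := isGroup.Build G mulA mul1 mulr1 mulV mulrV.

(** One chart for each of the two connected components, with the translation part as coordinate. *)
Definition isom_chart (b : bool) : chart G R^o :=
  Chart [set g | g.2 = b] fst (fun x => (x, b)).

Definition isom_atlas : set (chart G R^o) := range isom_chart.

Lemma reflection_linear b : linear (reflection b).
Proof. by case: b => k x y /=; rewrite ?scalerN ?opprD. Qed.

Lemma reflection_continuous b : continuous (reflection b).
Proof. by case: b => x; [apply: cvgN|]; exact: cvg_id. Qed.

Lemma isom_hausdorff : hausdorff_space G.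
Proof.
apply: (@prod_hausdorff R^o bool); last exact: discrete_hausdorff.
exact: norm_hausdorff.
Qed.

Lemma isom_atlasP : smooth_atlas isom_atlas.
Proof.
split=> [_ [b _ <-]|[x b]|_ _ [b _ <-] [c _ <-]]; last 1 first.
(* Every transition map is given by the identity formula, also for distinct components, where the
   overlap is empty. *)
- by apply: (@smooth_affine _ _ _ _ idfun 0) => // [? ?|z];
    [exact: cvg_id|rewrite addr0].
- split => /=.
  + rewrite (_ : [set g | _] = snd @^-1` [set b])//.
    by apply: open_comp => [? _|]; [exact: snd_continuous|exact: discrete_open].
  + rewrite (_ : _ @` _ = setT); first exact: openT.
    by apply/seteqP; split=> // x _; exists (x, b).
  + exact/continuous_subspaceT/fst_continuous.
  + apply: continuous_subspaceT.
    by apply: pair_continuous => x; [exact: cvg_id|exact: cvg_cst].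
  + by case=> x c /= ->.
- by exists (isom_chart b) => //; exists b.
Qed.

Lemma isom_mul_smooth : smooth_map (prod_atlas isom_atlas isom_atlas) isom_atlas
  (fun p : G * G => (p.1 * p.2)%g).
Proof.
split.
  (* The product formula depends on a discrete datum only through the linear part of the first
     factor. *)
  pose f b (p : G * G) : G := (p.1.1 + reflection b p.2.1, b (+) p.2.2).
  apply: (@continuous_glue _ _ (fun p : G * G => p.1.2) f) => [p|b].
    by apply: continuous_comp; [exact: fst_continuous|exact: snd_continuous].
  apply: (@pair_continuous _ R^o bool) => p.
    apply: cvgD; first by apply: continuous_comp; exact: fst_continuous.
    apply: (@continuous_comp _ _ _ (fun p : G * G => p.2.1) (reflection b)).
      by apply: continuous_comp; [exact: snd_continuous|exact: fst_continuous].
    exact: reflection_continuous.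
  apply: (@continuous_comp _ _ _ (fun p : G * G => p.2.2) (addb b)).
    by apply: continuous_comp; exact: snd_continuous.
  exact: discrete_continuous.
move=> _ _ [_ [a _ <-] [_ [b _ <-] <-]] [c _ <-] /=.
apply: (@smooth_affine _ _ _ _ (fun z : R^o * R^o => z.1 + reflection a z.2) 0).
- by move=> k x y /=; rewrite reflection_linear scalerDr addrACA.
- move=> p; apply: cvgD; first exact: fst_continuous.
  by apply: continuous_comp; [exact: snd_continuous|
                              exact: reflection_continuous].
- by move=> z; rewrite addr0.
Qed.

Lemma isom_inv_smooth :
  smooth_map isom_atlas isom_atlas (fun x : G => (x^-1)%g).
Proof.
split.
  apply: (@continuous_glue _ _ snd
    (fun b (g : G) => (- reflection b g.1, g.2) : G)).
    exact: snd_continuous.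
  move=> b.
  apply: (@pair_continuous _ R^o bool) => g; last exact: snd_continuous.
  apply: cvgN.
  by apply: continuous_comp; [exact: fst_continuous|
                              exact: reflection_continuous].
move=> _ _ [b _ <-] [c _ <-].
apply: (@smooth_affine _ _ _ _ (fun x : R^o => - reflection b x) 0).
- by move=> k x y; rewrite reflection_linear opprD scalerN.
- by move=> p; apply: cvgN; exact: reflection_continuous.
- by move=> z; rewrite addr0.
Qed.

Definition isomLine_lie : banachLieGroup R :=
  BanachLieGroup isom_hausdorff isom_atlasP isom_mul_smooth isom_inv_smooth.

(** Conjugating y |-> x + (-1)^b y by the translation by t gives y |-> t + x + (-1)^b (y - t), whose
    translation part is x + (t - (-1)^b t). *)
Definition translation_conj (t : R) (g : isomLine_lie) : isomLine_lie :=
  (g.1 + (t - reflection g.2 t), g.2).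

Lemma translation_conj_smooth_action : smooth_action translation_conj.
Proof.
split.
- move=> t [x a] [y b]; congr pair => /=.
  by case: a b => -[]/=; lra.
- by move=> [x []]; congr pair => /=; rewrite !oppr0 !addr0.
- by move=> s t [x []]; congr pair => /=; lra.
split.
  pose f b (p : R^o * G) : G := (p.2.1 + (p.1 - reflection b p.1), p.2.2).
  apply: (@continuous_glue _ _ (fun p : R^o * G => p.2.2) f) => [p|b].
    by apply: continuous_comp; exact: snd_continuous.
  apply: (@pair_continuous _ R^o bool) => p; last first.
    by apply: continuous_comp; exact: snd_continuous.
  apply: cvgD.
    by apply: continuous_comp; [exact: snd_continuous|exact: fst_continuous].
  apply: cvgB; first exact: fst_continuous.
  by apply: continuous_comp; [exact: fst_continuous|
                              exact: reflection_continuous].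
move=> _ _ [_ -> [_ [b _ <-] <-]] [c _ <-] /=.
apply: (@smooth_affine _ _ _ _
  (fun z : R^o * R^o => z.2 + (z.1 - reflection b z.1)) 0).
- move=> k x y /=.
  by rewrite reflection_linear !scalerDr scalerN opprD !addrA; lra.
- move=> p; apply: cvgD; first exact: snd_continuous.
  apply: cvgB; first exact: fst_continuous.
  by apply: continuous_comp; [exact: fst_continuous|
                              exact: reflection_continuous].
- by move=> z; rewrite addr0.
Qed.

End IsomLine.

(** * The representation on C^2 and its failure to be strict *)

Section Representation.
Variable R : realType.

Definition euclid_hilbert (n : nat) : hilbertSpace R :=
  HilbertSpace (@euclid_normE R n).

Lemma id_unitary (K : hilbertSpace R) : unitary (@id K).
Proof. by split=> // y; exists y. Qed.

(** For n = 2 this is the exchange of the two coordinates. *)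
Definition coord_rev (n : nat) (x : euclid_hilbert n) : euclid_hilbert n :=
  \row_j x 0 (rev_ord j).

Lemma coord_revK n : involutive (@coord_rev n).
Proof. by move=> x; apply/rowP => j; rewrite !mxE rev_ordK. Qed.

Lemma coord_rev_unitary n : unitary (@coord_rev n).
Proof.
split=> [k x y|x y|y].
- by apply/rowP => j; rewrite !mxE.
- rewrite /= !edotE (reindex_inj rev_ord_inj)/=.
  by apply: eq_bigr => j _; rewrite !mxE rev_ordK.
- by exists (coord_rev y); exact: coord_revK.
Qed.

Let H := euclid_hilbert 2.
Let G := isomLine_lie R.

Definition sign_rep (g : G) (x : H) : H := if g.2 then coord_rev x else x.

Lemma sign_rep_unitary g : unitary (sign_rep g).
Proof.
by rewrite /sign_rep; case: g.2; [exact: coord_rev_unitary|exact: id_unitary].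
Qed.

Lemma sign_repM g h x : sign_rep (g * h)%g x = sign_rep g (sign_rep h x).
Proof.
by case: g h => [a []] [b []]; rewrite /sign_rep/= ?coord_revK.
Qed.

Lemma component_continuous (T : topologicalType) (f : bool -> T) :
  continuous (fun g : G => f g.2).
Proof.
move=> g; apply: (@continuous_comp _ _ _ snd f); first exact: snd_continuous.
exact: discrete_continuous.
Qed.

Lemma sign_rep_continuous x : continuous (sign_rep^~ x).
Proof.
exact: (@component_continuous _ (fun b => if b then coord_rev x else x)).
Qed.

(** The graph of the zero operator, with domain all of [H]. *)
Let energy : set (H * H) := [set p | p.2 = 0].

Let energy_self_adjoint : self_adjoint energy.
Proof.
split.
  rewrite (_ : _ @` _ = setT); first by move=> A [x Ax] _; exists x.
  by apply/seteqP; split=> // x _; exists (x, 0).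
apply/seteqP; split=> [p pT|p p0 q q0].
  (* Testing against the graph element [(p.2, 0)] shows that [p.2] has inner product 0 with
     itself. *)
  have /eqP := pT (p.2, 0) erefl.
  by rewrite /= linear0l eq_sym dnorm_eq0 => /eqP.
by rewrite /= q0 p0 linear0l linear0r.
Qed.

Let energy_ge0 : nonnegative energy.
Proof. by move=> p p0; rewrite p0 linear0l. Qed.

Let energy_exp : generates energy (fun _ : R => id).
Proof.
move=> x y; rewrite /energy/=.
have c0 : (t^-1)%:C *: (x - x) @[t --> (0 : R)^'] --> (0 : H).
  by under eq_cvg do rewrite subrr scaler0; exact: cvg_cst.
split=> [->|xy]; first by rewrite scaler0.
have : 'i *: y = 0 by apply: cvg_unique xy c0; exact: norm_hausdorff.
by move/eqP; rewrite scaler_eq0 (negPf (neq0Ci _)) => /eqP.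
Qed.

(** Conjugation by a translation preserves the component, and [sign_rep] sees nothing else. *)
Let covariant t g x :
  id (sign_rep g (id x)) = sign_rep (translation_conj t g) x.
Proof. by []. Qed.

Definition sign_per : posEnergyRep (@translation_conj R) :=
  PosEnergyRep sign_rep_unitary sign_repM sign_rep_continuous
    (fun _ => id_unitary H) (fun _ _ _ => erefl)
    (fun x => @cst_continuous R H x)
    energy_self_adjoint energy_ge0 energy_exp covariant.

Lemma sign_ground_state : ground_state_rep sign_per.
Proof.
move=> A [x Ax] _; exists x; split=> //.
exists 1%N, (fun=> 1), (fun=> x); split; last by rewrite big_ord1 scale1r.
by move=> _; exists (1%g : G), x.
Qed.

Lemma sign_smooth : smooth_rep sign_per.
Proof.
move=> x x0; apply: subset_closure; split=> //; split.
  exact: (@component_continuous (realify H)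
    (fun b => if b then coord_rev x else x)).
move=> _ _ [b _ <-] ->.
apply: (@smooth_affine R R^o (realify H) _ (fun=> 0)
  (if b then coord_rev x else x)).
- by move=> k u v; rewrite scaler0 addr0.
- exact: cst_continuous.
- by move=> z; rewrite add0r.
Qed.

Lemma sign_fixed_points g x :
  fixed_points (@translation_conj R) g -> sign_rep g x = x.
Proof.
(* At t = 1 a reflection has its translation part shifted by 2, so a fixed point must be a
   translation, which acts trivially. *)
move=> /(_ 1)/(congr1 fst)/=; rewrite /sign_rep; case: g.2 => //= /eqP.
by rewrite opprK -subr_eq0 addrAC subrr add0r -mulr2n pnatr_eq0.
Qed.

Lemma sign_not_strict : ~ strict_rep sign_per.
Proof.
pose e0 : H := delta_mx 0 0.
pose A (x : H) : H := x 0 0 *: e0.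
move/(_ A) => [|g x gfix _|B [_ Bpi BA]].
- split=> // [k x y _ _|].
    by rewrite /A !mxE scalerDl scalerA.
  exists `|e0| => x _; rewrite /A normrZ mulrC ler_wpM2l//.
  exact: ler_euclid_coord.
- change (A (sign_rep g x) = sign_rep g (A x)).
  by rewrite !sign_fixed_points.
(* At the reflection [(0, true)] and the vector [e0], the left side is [A] of the second basis
   vector, which is 0, while the right side is the second basis vector itself. The last coordinate
   then gives 0 = 1. *)
have := Bpi ((0, true) : G) e0; rewrite !BA// /sign_rep/=.
move=> /rowP/(_ ord_max); rewrite /A !mxE/= mul0r mulr1 => /eqP.
by rewrite eq_sym oner_eq0.
Qed.

End Representation.

Theorem proposition4p9 (R : realType) :
  exists (G : banachLieGroup R) (alpha : R -> G -> G),
    smooth_action alpha /\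
    ~ (forall rho : posEnergyRep alpha,
         ground_state_rep rho -> smooth_rep rho -> strict_rep rho).
Proof.
exists (isomLine_lie R), (@translation_conj R); split.
  exact: translation_conj_smooth_action.
move=> strict; apply: (@sign_not_strict R); apply: strict.
  exact: sign_ground_state.
exact: sign_smooth.
Qed.
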